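(* Let $I$ be a set and for each $d\in\mathbf{N}$ let $(U_i)_{i\in I}=(U_{i,d})_{i\in I}$ be an independent family of random variables, each $U_{i,d}$ being a uniformly distributed random $d\times d$ permutation matrix. Let $J$ be a set and suppose for each $j\in J$ and $d\in\mathbf{N}$ that $B_j=B_{j,d}$ is a (non-random) $d\times d$ permutation matrix. Suppose that $\lim_{d\to\infty}\mathrm{tr}_d(B_{j,d})=0$ for every $j\in J$, and that for all $j_1,j_2\in J$, either $\lim_{d\to\infty}\operatorname{dist}(B_{j_1,d}B_{j_2,d},\mathrm{id}_d)=0$ or there exists $j_3\in J$ such that $\lim_{d\to\infty}\operatorname{dist}(B_{j_1,d}B_{j_2,d},B_{j_3,d})=0$. Then the family $$\big(\{U_i,U_i^*\}\big)_{i\in I},\ \{B_j\mid j\in J\}$$ is asymptotically free as $d\to\infty$, meaning that $$\lim_{d\to\infty}\mathbf{E}\big(\mathrm{tr}_d\big(w_0(U)B_{j_1}w_1(U)B_{j_2}\cdots w_{n-1}(U)B_{j_n}w_n(U)\big)\big)=0$$ whenever $n\ge 0$, $j_1,\ldots,j_n\in J$, $w_0,w_1,\ldots,w_n\in F_I$, the words $w_1,\ldots,w_{n-1}$ are nontrivial, and, if $n=0$, then $w_0$ is nontrivial.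
   Context: $\mathrm{tr}_d=\frac1d\mathrm{Tr}$ is the normalized trace on $M_d(\mathbf{C})$ and $\mathbf{E}$ is the expectation of the underlying probability space. $F_I=\langle x_i\mid i\in I\rangle$ is the free group with free generators $(x_i)_{i\in I}$; for $w\in F_I$, $w(U)$ is the (random) $d\times d$ permutation matrix obtained by replacing each $x_i$ in $w$ with $U_i$ and each $x_i^{-1}$ with $U_i^*$ (and $w(U)$ is the identity matrix if $w$ is the identity element); ''nontrivial'' means not the identity element of $F_I$. Permutation matrices are identified with their corresponding permutations in the symmetric group $S_d$, and $\operatorname{dist}(\sigma,\tau)$ for $\sigma,\tau\in S_d$ is the normalized Hamming distance: the number of points not fixed by $\sigma^{-1}\tau$, divided by $d$. $\mathrm{id}_d$ is the identity of $S_d$. *)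

(* Defs.v *)
From HB Require Import structures.
From mathcomp Require Import all_boot all_order all_algebra all_fingroup.
From mathcomp Require Import all_classical all_reals all_analysis.

Set Implicit Arguments.
Unset Strict Implicit.
Unset Printing Implicit Defensive.

Import GRing.Theory.
Import numFieldNormedType.Exports.

Local Open Scope classical_set_scope.
Local Open Scope ring_scope.

(* The free group F_I on an arbitrary type I, as the group of reduced words.
   The letter (i, true) is the generator x_i and (i, false) is its inverse. *)
Section free_group.
Variable I : Type.

Local Notation letter := ({classic I} * bool)%type.

Definition invl (a : letter) : letter := (a.1, ~~ a.2).

Definition reduced (w : seq letter) : bool :=
  sorted (fun a b => b != invl a) w.

Record free_group := FreeGroup {
  word_of :> seq letter;
  word_of_reduced : reduced word_of }.

HB.instance Definition _ := [isSub for word_of].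
HB.instance Definition _ := [Choice of free_group by <:].

Definition push (a : letter) (w : seq letter) : seq letter :=
  if w is b :: w' then if b == invl a then w' else a :: w else [:: a].

Definition mulw (u v : seq letter) : seq letter := foldr push v u.

Definition invw (w : seq letter) : seq letter := rev (map invl w).

Lemma invlK : involutive invl.
Proof. by case=> i b; rewrite /invl /= negbK. Qed.

Lemma invl_eqC a b : (b == invl a) = (a == invl b).
Proof. by rewrite -(can_eq invlK) invlK eq_sym. Qed.

Lemma reduced_behead a w : reduced (a :: w) -> reduced w.
Proof. exact: path_sorted. Qed.

Lemma push_reduced a w : reduced w -> reduced (push a w).
Proof.
case: w => [//|b w] /= bw; case: ifPn => [_|ba]; first exact: path_sorted bw.
by rewrite /reduced /= ba.
Qed.

Lemma mulw_reduced u v : reduced v -> reduced (mulw u v).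
Proof. by move=> v_red; elim: u => //= a u; exact: push_reduced. Qed.

Lemma invw_reduced w : reduced w -> reduced (invw w).
Proof.
rewrite /reduced /invw rev_sorted sorted_map; apply: sub_sorted => a b /=.
by rewrite invlK eq_sym.
Qed.

Lemma push_invl a w : reduced w -> push a (push (invl a) w) = w.
Proof.
case: w => [|b [|c w]] /=; rewrite ?eqxx// invlK.
  by case: (eqVneq b a) => [->//|_]; rewrite /= eqxx.
by case: (eqVneq b a) => [->/andP[/negPf ca _]|_ _]; rewrite /= ?ca ?eqxx.
Qed.

Lemma mulw_push a v w : reduced w -> mulw (push a v) w = push a (mulw v w).
Proof.
case: v => [//|b v] w_red /=; case: eqP => [->|//].
by rewrite push_invl// mulw_reduced.
Qed.

Lemma mulwA u v w : reduced w -> mulw u (mulw v w) = mulw (mulw u v) w.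
Proof. by move=> w_red; elim: u => //= a u ->; rewrite mulw_push. Qed.

Lemma mulw1 u : reduced u -> mulw u [::] = u.
Proof.
elim: u => //= a u IHu au; rewrite IHu ?(reduced_behead au)//.
by case: u au {IHu} => //= b u /andP[/negPf ->].
Qed.

Lemma mulVw w : mulw (invw w) w = [::].
Proof.
elim: w => // a w IHw; rewrite /invw /= rev_cons /mulw foldr_rcons /= invlK eqxx.
exact: IHw.
Qed.

Lemma invwK : involutive invw.
Proof. by move=> w; rewrite /invw map_rev revK mapK//; exact: invlK. Qed.

Definition free_one : free_group := @FreeGroup [::] isT.
Definition free_mul (u v : free_group) : free_group :=
  FreeGroup (mulw_reduced u (word_of_reduced v)).
Definition free_inv (u : free_group) : free_group :=
  FreeGroup (invw_reduced (word_of_reduced u)).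

Fact free_mulA : associative free_mul.
Proof. by move=> u v w; apply: val_inj; exact/mulwA/word_of_reduced. Qed.
Fact free_mul1l : left_id free_one free_mul.
Proof. by move=> u; exact: val_inj. Qed.
Fact free_mul1r : right_id free_one free_mul.
Proof. by move=> u; apply: val_inj; exact/mulw1/word_of_reduced. Qed.
Fact free_mulVl : left_inverse free_one free_inv free_mul.
Proof. by move=> u; apply: val_inj; exact: mulVw. Qed.
Fact free_mulVr : right_inverse free_one free_inv free_mul.
Proof. by move=> u; apply: val_inj; rewrite /= -{1}[val u]invwK; exact: mulVw. Qed.

HB.instance Definition _ := isGroup.Build free_group
  free_mulA free_mul1l free_mul1r free_mulVl free_mulVr.

End free_group.

(* w(U): each x_i becomes U_i and each inverse of x_i becomes U_i^*, which is the
   transpose of U_i because permutation matrices are real. *)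
Definition word_mx (R : realType) (d : nat) (I : Type) (U : I -> 'M[R]_d)
    (w : free_group I) : 'M[R]_d :=
  \prod_(a <- word_of w) (if a.2 then U a.1 else (U a.1)^T).

(* tr_d; its value at d = 0 is irrelevant, being used only as d tends to oo. *)
Definition ntr (R : realType) (d : nat) (A : 'M[R]_d) : R := \tr A / d%:R.

(* Products in 'S_d compose from left to right, matching perm_mx, which is
   multiplicative: perm_mx (s * t) = perm_mx s *m perm_mx t. *)
Definition hamming_dist (R : realType) (d : nat) (s t : 'S_d) : R :=
  #|[pred x : 'I_d | (s^-1 * t)%g x != x]|%:R / d%:R.

HB.instance Definition _ (T : finType) := isPointed.Build (perm_type T) 1%g.
HB.instance Definition _ (T : finType) :=
  @isMeasurable.Build default_measure_display (perm_type T)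
    discrete_measurable discrete_measurable0
    discrete_measurableC discrete_measurableU.

Definition independent_RVs d d' (T : measurableType d) (T' : measurableType d')
    (R : realType) (P : probability T R) (I : Type) (X : I -> {RV P >-> T'}) :=
  forall (k : nat) (i : 'I_k -> I), injective i ->
  forall A : 'I_k -> set T', (forall l, measurable (A l)) ->
  P (\bigcap_l (X (i l) @^-1` A l)) = (\prod_l P (X (i l) @^-1` A l))%E.

Definition uniform_perm d (T : measurableType d) (R : realType)
    (P : probability T R) (n : nat) (X : {RV P >-> 'S_n}) :=
  forall s : 'S_n, distribution P X [set s] = (n`!%:R^-1)%:E.

(* Main.v *)
Require Import Defs.
From mathcomp Require Import all_boot all_order all_algebra all_fingroup.
From mathcomp Require Import all_classical all_reals all_analysis.
From mathcomp Require Import measurable_realfun zify.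
Import numFieldNormedType.Exports.
Local Open Scope classical_set_scope.
Local Open Scope ring_scope.

(** The trace counts closed trajectories: [tr_d] of a permutation matrix is the
    proportion of fixed points, and a point [p] is fixed by
    [w_0(U) B_(j_1) w_1(U) ... B_(j_n) w_n(U)] when the walk that starts at [p]
    and applies the factors one after the other returns to [p].  Write the
    product as a deterministic permutation [c_0] followed by [L] steps
    [(a_1, c_1), ..., (a_L, c_L)], each of which applies a random letter
    [a_k = U_i] or [U_i^-1] and then a deterministic permutation [c_k].  The
    words are reduced and the inner ones are nonempty, so whenever
    [a_(k+1) = a_k^-1] the permutation [c_k] standing between them is one of the
    [B_j], and it has only [o(d)] fixed points.

    Fix [p] and reveal the uniform permutations along the walk only when they
    are queried.  As long as each query asks for a value that is not determined
    by the previous answers, its answer is uniform among at least [d - L]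
    points ([nsat_fresh]).  The walk then moves on to [c_k t], where [t] is this
    answer, and the next query is determined only if [c_k t] hits one of at most
    [L] points that were known before, or if [a_(k+1) = a_k^-1] and [c_k t = t]
    ([card_bad_targets]).  So each query has probability at most
    [(L + 1 + f) / (d - L)] of making the next one determined, where [f] bounds
    the numbers of fixed points of the [B_j]; and if this never happens, the
    last answer must be the single point that closes the walk, which has
    probability at most [1 / (d - L)].  Induction on the steps
    ([nsat_run_fresh]) bounds the probability of return by
    [(L + 1) (L + 1 + f) / (d - L)], hence the expected trace
    ([expectation_ntr_steps]), and this tends to [0] because [f / d] does.

    Probabilities are counted in the finite set of families of permutations
    indexed by the generators that occur in the words, over which independence
    and uniformity turn the expectation into a plain average
    ([expectation_uniform_family]).  When there are no letters at all, the
    product is a single [B_j], whose trace tends to [0]. *)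

Set Implicit Arguments.
Unset Strict Implicit.
Unset Printing Implicit Defensive.
Import Order.TTheory GRing.Theory Num.Theory.

(** * Letters, steps and walks *)

Section Exposure.
Local Open Scope nat_scope.
Variables (K : finType) (d : nat).
Implicit Types (U V : {ffun K -> 'S_d}) (a b : K * bool) (x y t p : 'I_d).

Definition flip (T : Type) (a : T * bool) := (a.1, ~~ a.2).
Lemma flipK (T : Type) : involutive (@flip T).
Proof. by case=> k e; rewrite /flip /= negbK. Qed.
Lemma flip_neq (T : eqType) (a : T * bool) : flip a != a.
Proof. by case: a => k [] ; apply/eqP => -[]. Qed.

Definition letter_perm (T : Type) (V : T -> 'S_d) (a : T * bool) : 'S_d :=
  if a.2 then V a.1 else ((V a.1)^-1)%g.

(** Permutations compose from left to right, so the walk applies the letter of a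
    step before its permutation. *)
Definition run (T : Type) (V : T -> 'S_d) (st : seq ((T * bool) * 'S_d)) x :
    'I_d :=
  foldl (fun y (e : (T * bool) * 'S_d) => e.2 (letter_perm V e.1 y)) x st.

Lemma letter_perm_flip (T : Type) (V : T -> 'S_d) (a : T * bool) :
  letter_perm V (flip a) = ((letter_perm V a)^-1)%g.
Proof. by case: a => k [] //=; rewrite /letter_perm /= invgK. Qed.

(** * Exposing uniform permutations along a walk *)

(** The edge [(a, x, t)] records the answer [t] to the query of the letter [a]
    at [x]. *)
Local Notation edge := ((K * bool) * 'I_d * 'I_d)%type.

Definition sat (h : seq edge) U := all (fun e => letter_perm U e.1.1 e.1.2 == e.2) h.

(** The known edges constrain a letter and its inverse together: a traversal of
    [flip a] from [s] to [t] also reveals the value of [a] at [t]. *)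
Definition endpoint a (e : edge) : option 'I_d :=
  if e.1.1 == a then Some e.1.2 else if e.1.1 == flip a then Some e.2 else None.

Definition exposed (h : seq edge) a : seq 'I_d := pmap (endpoint a) h.

Lemma exposed_cons e h a : exposed (e :: h) a =
  if e.1.1 == a then e.1.2 :: exposed h a
  else if e.1.1 == flip a then e.2 :: exposed h a else exposed h a.
Proof.
rewrite /exposed /= [endpoint a e]/endpoint.
by case: (_ == a) => //; case: (_ == flip a).
Qed.

Lemma size_exposed h a : (size (exposed h a) <= size h)%N.
Proof. by rewrite size_pmap count_size. Qed.

(** Composing with a transposition the permutation that the letter [a] stands
    for, on the side where it acts on the answers to [a], redirects the answer
    [t] to [t'].  This bijection makes all undetermined answers equally
    likely. *)
Definition reroute U a t t' : {ffun K -> 'S_d} :=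
  [ffun k => if k == a.1 then if a.2 then U k * tperm t t' else tperm t t' * U k
             else U k]%g.

Lemma rerouteK a t t' : involutive (fun U => reroute U a t t').
Proof.
move=> U; apply/ffunP => k; rewrite !ffunE; case: (k == a.1) => //.
by case: a.2; [rewrite -mulgA tperm2 mulg1|rewrite mulgA tperm2 mul1g].
Qed.

Lemma letter_reroute U a t t' :
  letter_perm (reroute U a t t') a = (letter_perm U a * tperm t t')%g.
Proof.
by rewrite /letter_perm ffunE eqxx; case: a.2; rewrite // invMg tpermV.
Qed.

Lemma letter_reroute_neq U a b t t' : b != a -> b != flip a ->
  letter_perm (reroute U a t t') b = letter_perm U b.
Proof.
case: a b => [k e] [l f]; rewrite /letter_perm /flip ffunE /= !xpair_eqE.
by case: eqP => //= _; case: e f => [] [].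
Qed.

Lemma exposed_source (h : seq edge) e : e \in h -> e.1.2 \in exposed h e.1.1.
Proof.
by move=> he; rewrite mem_pmap; apply/mapP; exists e => //; rewrite /endpoint eqxx.
Qed.

Lemma exposed_target (h : seq edge) e : e \in h -> e.2 \in exposed h (flip e.1.1).
Proof.
move=> he; rewrite mem_pmap; apply/mapP; exists e => //.
by rewrite /endpoint flipK eq_sym (negPf (flip_neq _)) eqxx.
Qed.

(** A known edge survives because it touches neither [t], which is the image of
    the unexposed point [x], nor [t'], which is unexposed for the inverse
    letter. *)
Lemma sat_reroute h U a x t t' : x \notin exposed h a ->
    t' \notin exposed h (flip a) ->
  sat ((a, x, t) :: h) U -> sat ((a, x, t') :: h) (reroute U a t t').
Proof.
move=> xh t'h /= /andP[/eqP Uxt Uh].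
rewrite letter_reroute permM Uxt tpermL eqxx /=.
apply/allP => -[[b s] u] he; have /= /eqP Usu := allP Uh _ he; rewrite /=.
have [eb|nb] := eqVneq b a.
  subst b; rewrite letter_reroute permM Usu tpermD //.
    apply: contraNneq xh => tu; rewrite -tu -Uxt in Usu.
    by rewrite -(perm_inj Usu); exact: (exposed_source he).
  by apply: contraNneq t'h => ->; exact: (exposed_target he).
have [eb|nb'] := eqVneq b (flip a); last by rewrite letter_reroute_neq // Usu.
subst b; rewrite letter_perm_flip letter_reroute invMg tpermV permM.
rewrite letter_perm_flip in Usu.
rewrite tpermD ?Usu //.
  apply: contraNneq xh => ts; move: Usu; rewrite -ts -Uxt permK => ->.
  by have := exposed_target he; rewrite /= flipK.
by apply: contraNneq t'h => ->; exact: (exposed_source he).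
Qed.

Definition nsat h := #|[pred U | sat h U]|.

Lemma nsat_sum h a x : nsat h = \sum_t nsat ((a, x, t) :: h).
Proof.
rewrite /nsat -sum1_card (partition_big (fun U => letter_perm U a x) predT) //=.
apply: eq_bigr => t _; rewrite -sum1_card; apply: eq_bigl => U.
by rewrite !inE /= andbC.
Qed.

(** The answer to a query at an unexposed point is nearly uniform: rerouting gives
    every [t'] that is not yet an answer at least as many families as [t], and
    there are at least [d - size h] such [t']. *)
Lemma nsat_fresh h a x t : x \notin exposed h a ->
  (nsat ((a, x, t) :: h) * (d - size h) <= nsat h)%N.
Proof.
move=> xh; rewrite (nsat_sum h a x) mulnC.
apply: (@leq_trans (\sum_(t' | t' \notin exposed h (flip a)) nsat ((a, x, t) :: h))).
  rewrite sum_nat_const leq_mul2r; apply/orP; right.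
  rewrite leq_subLR -[X in (X <= _)%N]card_ord -(cardC (mem (exposed h (flip a)))).
  by apply: leq_add => //; apply: leq_trans (card_size _) (size_exposed _ _).
rewrite [X in (_ <= X)%N](bigID (fun t' => t' \notin exposed h (flip a))) /=.
apply: leq_trans (leq_addr _ _); apply: leq_sum => t' t'h.
rewrite /nsat -(fintype.card_image (can_inj (rerouteK a t t'))).
apply: subset_leq_card; apply/fintype.subsetP => _ /fintype.imageP[U UE ->].
by rewrite inE; apply: sat_reroute.
Qed.

Definition fixed_points (c : 'S_d) := #|[pred x | c x == x]|.

(** If the next letter undoes the last one, then the walk retraces the edge that
    it has just crossed exactly at the fixed points of the permutation in
    between. *)
Definition rarely_retraces (T : eqType) f (e e' : (T * bool) * 'S_d) :=
  (e'.1 == flip e.1) ==> (fixed_points e.2 <= f)%N.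

(** The answers after which the next query is determined.  Each old edge exposes
    at most one point for [b].  The new edge exposes [x] when [b = a]; when
    [b = flip a] it exposes its own answer [t], which is hit exactly at the fixed
    points of [c]. *)
Lemma card_bad_targets h a b c x f :
  ((b == flip a) ==> (fixed_points c <= f))%N ->
  (#|[pred t | c t \in exposed ((a, x, t) :: h) b]| <= (size h).+1 + f)%N.
Proof.
move=> back.
have le1 : (#|[pred t | c t \in x :: exposed h b]| <= (size h).+1)%N.
  rewrite -(fintype.card_image (@perm_inj _ c)).
  apply: leq_trans (_ : size (x :: exposed h b) <= _)%N; last first.
    by rewrite ltnS size_exposed.
  apply: leq_trans (card_size _); apply: subset_leq_card.
  by apply/fintype.subsetP => _ /fintype.imageP[t th ->].
have [/eqP ba|nba] := boolP (b == flip a).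
  rewrite ba eqxx /= in back.
  apply: leq_trans (leq_add le1 back); rewrite -cardUI.
  apply: leq_trans (leq_addr _ _); apply: subset_leq_card; apply/fintype.subsetP => t.
  rewrite !inE exposed_cons /= ba flipK eqxx eq_sym (negPf (flip_neq a)).
  by rewrite in_cons => /orP[|] ->; rewrite ?orbT.
apply: leq_trans (leq_trans le1 (leq_addr _ _)); apply: subset_leq_card.
apply/fintype.subsetP => t; rewrite !inE exposed_cons /=.
have [ab|nab] := eqVneq a b; first by rewrite inE.
have [ab|_] := eqVneq a (flip b); last by move=> ->; rewrite orbT.
by rewrite ab flipK eqxx in nba.
Qed.

(** Induction on the steps.  Each step but the last pays
    [(m + 1 + f) / (d - m)] for the answers after which the next query is
    determined, and the other answers leave a fresh walk with one edge more; the
    last step must hit the preimage of [p]. *)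
Lemma nsat_run_fresh st h e f m x p :
    x \notin exposed h e.1 -> sorted (rarely_retraces f) (e :: st) ->
    (size h + size (e :: st) <= m)%N ->
  (#|[pred U | sat h U & run U (e :: st) x == p]| * (d - m)
     <= nsat h * (size (e :: st) * (m.+1 + f)))%N.
Proof.
elim: st h e x => [|e' st IH] h [a c] x /= xh; rewrite ?andbT => st_ok hm.
  have hm' : (d - m <= d - size h)%N.
    by apply: leq_sub2l; apply: leq_trans hm; exact: leq_addr.
  (* Only the answer [c^-1 p] brings the walk to [p]. *)
  rewrite mul1n; apply: leq_trans (_ : nsat h * 1 <= _)%N; last first.
    by rewrite leq_mul2l orbT.
  rewrite muln1; apply: leq_trans (nsat_fresh (c^-1%g p) xh).
  apply: leq_mul => //; apply: subset_leq_card; apply/fintype.subsetP => U.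
  by rewrite !inE /= => /andP[-> /eqP <-]; rewrite permK eqxx.
have {st_ok}[back st_ok] := andP st_ok.
have hm' : (d - m <= d - size h)%N.
  by apply: leq_sub2l; apply: leq_trans hm; exact: leq_addr.
pose bad t := c t \in exposed ((a, x, t) :: h) e'.1.
(* Split according to the answer [t] to the first query. *)
have -> : #|[pred U | sat h U
                    & run U (e' :: st) (c (letter_perm U a x)) == p]| =
    \sum_t #|[pred U | sat ((a, x, t) :: h) U
                     & run U (e' :: st) (c t) == p]|.
  rewrite -sum1_card (partition_big (fun U => letter_perm U a x) predT) //=.
  apply: eq_bigr => t _; rewrite -sum1_card; apply: eq_bigl => U.
  by rewrite !inE /=; case: (letter_perm U a x =P t) => [->|]; rewrite ?andbF ?andbT.
rewrite (bigID bad) /= mulnDl [(size st).+2 * _]mulSn mulnDr.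
apply: leq_add.
  (* The bad answers are few, and none is shared by more than
     [nsat h / (d - m)] families. *)
  apply: leq_trans (_ : \sum_(t | bad t) nsat h <= _)%N.
    rewrite big_distrl /=; apply: leq_sum => t _.
    apply: leq_trans (nsat_fresh t xh); apply: leq_mul => //.
    by apply: subset_leq_card; apply/fintype.subsetP => U; rewrite !inE => /andP[].
  rewrite sum_nat_const mulnC leq_mul2l; apply/orP; right.
  apply: leq_trans (card_bad_targets h x back) _.
  by rewrite leq_add2r ltnS; apply: leq_trans hm; exact: leq_addr.
(* The good answers: the induction hypothesis applies to each of them. *)
rewrite (nsat_sum h a x) big_distrl /= [X in (_ <= X)%N]big_distrl /=.
rewrite [X in (_ <= X)%N](bigID bad) /=; apply: leq_trans (leq_addl _ _).
by apply: leq_sum => t tok; apply: IH; rewrite //= addSnnS.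
Qed.

End Exposure.

(** * Counting fixed points of the product *)

Section Closing.
Local Open Scope nat_scope.
Variables (K : finType) (d : nat).

Definition steps_perm (T : Type) (V : T -> 'S_d)
    (s : 'S_d * seq ((T * bool) * 'S_d)) : 'S_d :=
  (s.1 * \prod_(e <- s.2) (letter_perm V e.1 * e.2))%g.

Lemma steps_permE (T : Type) (V : T -> 'S_d) s x :
  steps_perm V s x = run V s.2 (s.1 x).
Proof.
rewrite /steps_perm permM; move: (s.1 x) => {}x.
elim: s.2 x => [|e st IH] x; first by rewrite big_nil perm1.
by rewrite big_cons !permM IH.
Qed.

(** Without any step, the product is the single permutation [s.1]; otherwise the
    walk from each of the [d] starting points begins with nothing exposed.  The
    factor [(size s.2).+1] in place of [size s.2] lets one bound serve both
    cases. *)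
Lemma sum_fixed_points_le (s : 'S_d * seq ((K * bool) * 'S_d)) f :
    sorted (rarely_retraces f) s.2 -> (s.2 = [::] -> fixed_points s.1 <= f)%N ->
  ((\sum_(U : {ffun K -> 'S_d}) fixed_points (steps_perm U s)) * (d - size s.2)
     <= #|{ffun K -> 'S_d}| * d * ((size s.2).+1 * ((size s.2).+1 + f)))%N.
Proof.
case: s => c [|e st] /= st_ok c_fix.
  under eq_bigr do rewrite /steps_perm /= big_nil mulg1.
  rewrite sum_nat_const subn0 mul1n mulnAC leq_mul2l; apply/orP; right.
  exact: leq_trans (c_fix erefl) (leq_addl _ _).
have -> : (\sum_(U : {ffun K -> 'S_d}) fixed_points (steps_perm U (c, e :: st)) =
    \sum_(p : 'I_d) #|[pred U : {ffun K -> 'S_d} |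
                       sat [::] U & run U (e :: st) (c p) == p]|)%N.
  under eq_bigr do rewrite /fixed_points -sum1_card.
  under [RHS]eq_bigr do rewrite -sum1_card.
  rewrite (exchange_big_dep predT) //=; apply: eq_bigr => p _; apply: eq_bigl => U.
  by rewrite !inE steps_permE.
rewrite big_distrl /= -mulnA mulnCA -[X in (_ <= X * _)%N]card_ord -sum_nat_const.
apply: leq_sum => p _.
have := @nsat_run_fresh _ _ st [::] e f (size st).+1 (c p) p isT st_ok (leqnn _).
move=> /leq_trans; apply; apply: leq_mul; first exact: max_card.
by rewrite leq_mul2r leqnSn orbT.
Qed.

End Closing.

(** * Flattening alternating products into steps *)

Section Steps.
Local Open Scope nat_scope.
Variables (T : Type) (d : nat).
Local Notation steps := ('S_d * seq ((T * bool) * 'S_d))%type.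

Fixpoint word_steps (w : seq (T * bool)) (s : steps) : steps :=
  if w is a :: w' then
    let s' := word_steps w' s in (1%g, (a, s'.1) :: s'.2)
  else s.

Definition block_steps (bw : seq ('S_d * seq (T * bool))) : steps :=
  foldr (fun b s => let s' := word_steps b.2 s in ((b.1 * s'.1)%g, s'.2))
        (1%g, [::]) bw.

Lemma steps_perm_word (V : T -> 'S_d) w s :
  steps_perm V (word_steps w s) =
  (\prod_(a <- w) letter_perm V a * steps_perm V s)%g.
Proof.
elim: w => [|a w IH] /=; first by rewrite big_nil mul1g.
by rewrite big_cons -!mulgA -IH /steps_perm /= mul1g big_cons mulgA.
Qed.

Lemma steps_perm_block (V : T -> 'S_d) bw :
  steps_perm V (block_steps bw) =
  (\prod_(b <- bw) (b.1 * \prod_(a <- b.2) letter_perm V a))%g.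
Proof.
elim: bw => [|b bw IH] /=; first by rewrite /steps_perm !big_nil mulg1.
by rewrite big_cons -!mulgA -IH -steps_perm_word /steps_perm /= !mulgA.
Qed.

Lemma size_word_steps w s : size (word_steps w s).2 = (size w + size s.2)%N.
Proof. by elim: w => //= a w ->. Qed.

Lemma size_block_steps bw :
  size (block_steps bw).2 = (\sum_(b <- bw) size b.2)%N.
Proof.
by elim: bw => [|b bw IH] /=; rewrite ?big_nil// big_cons size_word_steps IH.
Qed.

End Steps.

Section StepsSorted.
Local Open Scope nat_scope.
Variables (T : eqType) (d : nat).
Implicit Types (s : 'S_d * seq ((T * bool) * 'S_d)).

Definition no_backtrack (w : seq (T * bool)) := sorted (fun a b => b != flip a) w.

(** Inside a reduced word no step goes back.  Only its last letter can be undone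
    by the first letter of [s], and then the permutation in between is
    [s.1]. *)
Lemma word_steps_sorted f w s : no_backtrack w -> sorted (rarely_retraces f) s.2 ->
    (s.2 != [::] -> fixed_points s.1 <= f)%N ->
  sorted (rarely_retraces f) (word_steps w s).2.
Proof.
move=> + s_ok s_fix; elim: w => //= a w IH aw.
have {IH} := IH (path_sorted aw); case: w aw => [|b w] /=.
  case: s s_fix {s_ok} => c [|e st] //= /(_ isT) c_fix _ ->.
  by rewrite andbT /rarely_retraces /= c_fix implybT.
by move=> /andP[ab _] ->; rewrite /rarely_retraces /= (negPf ab).
Qed.

(** As [sorted] compares neighbours, this exempts the last block. *)
Definition inner_nonempty (bw : seq ('S_d * seq (T * bool))) :=
  sorted (fun b _ => b.2 != [::]) bw.

(** Two deterministic permutations never merge, since only the last block may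
    have an empty word. *)
Lemma block_steps_head b bw : inner_nonempty (b :: bw) ->
  (block_steps (b :: bw)).1 = b.1.
Proof.
case: b bw => c [|a w] [|b' bw] //=; by rewrite mulg1.
Qed.

Lemma block_steps_sorted f bw : inner_nonempty bw ->
    all (fun b => no_backtrack b.2 && (fixed_points b.1 <= f)%N) bw ->
  sorted (rarely_retraces f) (block_steps bw).2 /\
  ((block_steps bw).2 != [::] -> fixed_points (block_steps bw).1 <= f)%N.
Proof.
elim: bw => [//|b bw IH] bw_in /[dup] bw_ok /= /andP[/andP[b_red b_fix] bw_ok'].
have [|IH1 IH2] := IH _ bw_ok'; first exact: path_sorted bw_in.
split; first exact: word_steps_sorted.
by move=> _; have /= -> := block_steps_head bw_in.
Qed.

End StepsSorted.

(** * From expectations to averages *)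

Lemma expectation_uniform_family disp (Omega : measurableType disp) (R : realType)
    (P : probability Omega R) (I : Type) d (U : I -> {RV P >-> 'S_d})
    (K : finType) (e : K -> I) (G : {ffun K -> 'S_d} -> R) :
    independent_RVs U -> (forall i, uniform_perm (U i)) -> injective e ->
    (forall V, 0 <= G V) ->
  'E_P[fun x => G [ffun k => U (e k) x]]%E =
  ((\sum_V G V) / #|{ffun K -> 'S_d}|%:R)%:E.
Proof.
move=> U_indep U_unif e_inj G0.
pose i (l : 'I_#|K|) := e (enum_val l).
have i_inj : injective i by move=> l l' /e_inj/enum_val_inj.
pose A V := \bigcap_l (U (i l) @^-1` [set (V : {ffun K -> 'S_d}) (enum_val l)]).
have mA V : measurable (A V).
  apply: fin_bigcap_measurable => // l _.
  by rewrite -[X in measurable X]setTI; exact: measurable_funPT.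
have AE V x : A V x <-> [ffun k => U (e k) x] = V.
  split=> [Ax|<- l _]; last by rewrite /= ffunE.
  apply/ffunP => k; rewrite ffunE.
  by have := Ax (enum_rank k) Logic.I; rewrite /i /= enum_rankK.
have PA V : P (A V) = (#|{ffun K -> 'S_d}|%:R^-1)%:E.
  rewrite (U_indep _ i i_inj (fun l => [set V (enum_val l)])) //.
  rewrite (eq_bigr (fun=> (d`!%:R^-1)%:E)); last by move=> l _; exact: U_unif.
  by rewrite prodEFin prodr_const card_ord card_ffun card_Sn natrX exprVn.
rewrite unlock.
have -> : (fun x => (G [ffun k => U (e k) x])%:E) =
    (fun x => \sum_(V : {ffun K -> 'S_d}) ((G V)%:E * (\1_(A V) x)%:E))%E.
  apply/funext => x; rewrite (bigD1 [ffun k => U (e k) x]) //= big1 ?adde0.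
    by rewrite indicE mem_set ?mule1 //; exact/AE.
  move=> V; rewrite eq_sym indicE => xV; rewrite memNset ?mule0 // => /AE xE.
  by rewrite xE eqxx in xV.
rewrite ge0_integral_sum //; last first.
- by move=> V x _; rewrite mule_ge0 // lee_fin // indicE ler0n.
- move=> V; apply: measurable_funeM; apply/measurable_EFinP.
  exact: measurable_indic.
rewrite mulr_suml -sumEFin; apply: eq_bigr => V _.
rewrite ge0_integralZl_EFin //.
  by rewrite integral_indic // setIT EFinM; congr (_ * _)%E; exact: PA.
by apply/measurable_EFinP; exact: measurable_indic.
Qed.

Lemma trace_perm_mx (R : realType) d (s : 'S_d) :
  ntr (perm_mx s) = (fixed_points s)%:R / d%:R :> R.
Proof.
rewrite /ntr /mxtrace; congr (_ / _).
under eq_bigr do rewrite !mxE.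
by rewrite -natr_sum -big_mkcond sum1_card.
Qed.

Lemma word_mx_perm (R : realType) d (I : Type) (V : I -> 'S_d)
    (w : free_group I) :
  word_mx (fun i => perm_mx (V i) : 'M[R]_d) w =
  perm_mx (\prod_(a <- word_of w) letter_perm V a)%g.
Proof.
rewrite /word_mx; elim: (word_of w) => [|a u IH].
  by rewrite !big_nil perm_mx1.
by rewrite !big_cons IH perm_mxM /letter_perm; case: a.2; rewrite ?tr_perm_mx.
Qed.

Lemma steps_perm_map d (T T' : Type) (g : T -> T') (V : T' -> 'S_d) c st :
  steps_perm V (c, [seq ((g e.1.1, e.1.2), e.2) | e <- st]) =
  steps_perm (V \o g) (c, st).
Proof. by rewrite /steps_perm /= big_map. Qed.

Lemma map_preimage (A : Type) (B : eqType) (g : A -> B) (l : seq B) :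
  {in l, forall b, exists a, g a = b} -> exists l', l = [seq g a | a <- l'].
Proof.
elim: l => [|b l IH] gl; first by exists [::].
have [|l' ->] := IH; first by move=> b' b'l; apply: gl; rewrite inE b'l orbT.
by have [|a <-] := gl b; [rewrite inE eqxx|exists (a :: l')].
Qed.

Lemma expectation_ntr_steps_le disp (Omega : measurableType disp) (R : realType)
    (P : probability Omega R) (I : Type) d (U : I -> {RV P >-> 'S_d})
    (K : finType) (e : K -> I) f (s : 'S_d * seq ((K * bool) * 'S_d)) :
    independent_RVs U -> (forall i, uniform_perm (U i)) -> injective e ->
    sorted (rarely_retraces f) s.2 -> (s.2 = [::] -> fixed_points s.1 <= f)%N ->
    (size s.2 < d)%N ->
  exists2 r : R,
    'E_P[fun x => ntr (perm_mx (steps_perm (fun k => U (e k) x) s))]%E = r%:E &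
    0 <= r <= ((size s.2).+1 * ((size s.2).+1 + f))%:R / (d - size s.2)%:R.
Proof.
move=> U_indep U_unif e_inj s_ok s_fix s_d.
pose G (V : {ffun K -> 'S_d}) : R := ntr (perm_mx (steps_perm V s)).
exists ((\sum_V G V) / #|{ffun K -> 'S_d}|%:R).
  rewrite -(@expectation_uniform_family _ _ _ _ _ _ _ K e G
              U_indep U_unif e_inj).
    congr expectation; apply/funext => x; congr (ntr (perm_mx _)).
    rewrite /steps_perm; congr (_ * _)%g; apply: eq_bigr => a _.
    by rewrite /letter_perm /= ffunE.
  by move=> V; rewrite /G trace_perm_mx divr_ge0.
rewrite /G; under eq_bigr do rewrite trace_perm_mx.
rewrite -mulr_suml -natr_sum.
apply/andP; split; first by rewrite !divr_ge0.
have d0 : (0 < d)%N by exact: leq_ltn_trans s_d.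
have c0 : (0 < #|{ffun K -> 'S_d}|)%N.
  by rewrite card_ffun expn_gt0 card_Sn fact_gt0.
rewrite -mulrA -invfM -natrM ler_pdivrMr ?ltr0n ?muln_gt0 ?d0 ?c0 //.
rewrite mulrAC ler_pdivlMr ?ltr0n ?subn_gt0 // -!natrM ler_nat.
apply: leq_trans (sum_fixed_points_le s_ok s_fix) _.
by rewrite mulnC [(d * _)%N]mulnC.
Qed.

Lemma steps_finite_alphabet (I : Type) d
    (st : seq (({classic I} * bool) * 'S_d)) :
  exists (K : finType) (e : K -> {classic I}) (st' : seq ((K * bool) * 'S_d)),
    injective e /\ st = [seq ((e a.1.1, a.1.2), a.2) | a <- st'].
Proof.
pose K := seq_sub [seq a.1.1 | a <- st].
exists K, val; have [|st' st'E] := @map_preimage ((K * bool) * 'S_d) _ 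
    (fun a => ((val a.1.1, a.1.2), a.2)) st.
  move=> [[i b] c'] /(map_f (fun a => a.1.1)) /= ist.
  by exists ((SeqSub ist, b), c').
by exists st'; split => //; exact: val_inj.
Qed.

(** The finitely many generators occurring in the steps form the index set of the
    finite average. *)
Lemma expectation_ntr_steps disp (Omega : measurableType disp) (R : realType)
    (P : probability Omega R) (I : Type) d (U : I -> {RV P >-> 'S_d}) f
    (s : 'S_d * seq (({classic I} * bool) * 'S_d)) :
    independent_RVs U -> (forall i, uniform_perm (U i)) ->
    sorted (rarely_retraces f) s.2 -> (s.2 = [::] -> fixed_points s.1 <= f)%N ->
    (size s.2 < d)%N ->
  exists2 r : R,
    'E_P[fun x => ntr (perm_mx (steps_perm (fun i => U i x) s))]%E = r%:E &
    0 <= r <= ((size s.2).+1 * ((size s.2).+1 + f))%:R / (d - size s.2)%:R.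
Proof.
case: s => c st /= U_indep U_unif.
have [K [e [st' [e_inj ->]]]] := steps_finite_alphabet st.
rewrite size_map sorted_map => st_ok c_fix st_d.
have st'_ok : sorted (rarely_retraces f) st'.
  apply: sub_sorted st_ok => -[[k b] c1] [[k' b'] c2].
  by rewrite /rarely_retraces /= /flip /= !xpair_eqE /= (inj_eq e_inj).
have c_fix' : (st' = [::] -> fixed_points c <= f)%N.
  by move=> st'0; apply: c_fix; rewrite st'0.
have [r rE r_le] :=
  @expectation_ntr_steps_le _ _ _ _ _ _ U K e f (c, st')
    U_indep U_unif e_inj st'_ok c_fix' st_d.
exists r => //; rewrite -rE; congr expectation; apply/funext => x.
by rewrite steps_perm_map.
Qed.

(** * The limit *)

(** As soon as [2 * L < d], the denominator exceeds [d / 2]. *)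
Lemma cvg_steps_bound (R : realType) (L : nat) (f : nat -> nat) :
  (f d)%:R / d%:R @[d --> \oo] --> (0 : R) ->
  (L.+1 * (L.+1 + f d))%:R / (d - L)%:R @[d --> \oo] --> (0 : R).
Proof.
move=> f0; pose A : R := L.+1%:R.
have inv0 : d%:R^-1 @[d --> \oo] --> (0 : R).
  by rewrite -(@cvg_shiftS _ (fun d => d%:R^-1 : R)); exact: cvg_harmonic.
have lim0 : 2 * A * (A * d%:R^-1 + (f d)%:R / d%:R) @[d --> \oo] --> (0 : R).
  rewrite -[X in _ --> X](mulr0 (2 * A)); apply: cvgM; first exact: cvg_cst.
  rewrite -[X in _ --> X](addr0 0); apply: cvgD => //.
  rewrite -[X in _ --> X](mulr0 A); apply: cvgM => //; exact: cvg_cst.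
apply: (squeeze_cvgr _ (cvg_cst 0) lim0); near=> d.
have dL : (L.*2 < d)%N by near: d; exact: nbhs_infty_gt.
have d0 : (0 < d)%N by exact: leq_ltn_trans dL.
have dL0 : (0 < d - L)%N.
  by rewrite subn_gt0; apply: leq_ltn_trans dL; rewrite -addnn leq_addr.
rewrite divr_ge0 //= ler_pdivrMr ?ltr0n //.
have -> : 2 * A * (A / d%:R + (f d)%:R / d%:R) * (d - L)%:R =
    (2 * (L.+1 * (L.+1 + f d)) * (d - L))%:R / d%:R :> R.
  by rewrite -mulrDl !natrM natrD !mulrA mulrAC.
rewrite ler_pdivlMr ?ltr0n // -natrM ler_nat.
move: (L.+1 * _)%N => X; rewrite [(2 * X)%N]mulnC -mulnA leq_mul2l.
by apply/orP; right; lia.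
Unshelve. all: by end_near. Qed.

Unset Implicit Arguments.

Theorem theorem4p1 (R : realType)
    (disp : nat -> measure_display) (Omega : forall d, measurableType (disp d))
    (P : forall d, probability (Omega d) R)
    (I : Type) (U : forall d, I -> {RV (P d) >-> 'S_d})
    (J : Type) (B : forall d, J -> 'S_d)
    (U_indep : forall d, independent_RVs (U d))
    (U_unif : forall d i, uniform_perm (U d i))
    (B_tr : forall j, ntr (perm_mx (B d j)) @[d --> \oo] --> (0 : R))
    (B_mul : forall j1 j2 : J,
      (hamming_dist R (B d j1 * B d j2)%g 1%g @[d --> \oo] --> (0 : R)) \/
      (exists j3 : J,
         hamming_dist R (B d j1 * B d j2)%g (B d j3) @[d --> \oo] --> (0 : R)))
    (n : nat) (j : 'I_n -> J) (w : 'I_n.+1 -> free_group I)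
    (w_inner : forall k : 'I_n.+1, (0 < k < n)%N -> w k <> 1%g)
    (w_n0 : n = 0%N -> w ord0 <> 1%g) :
  ('E_(P d)[fun x =>
     let Ux (i : I) : 'M[R]_d := perm_mx (U d i x) in
     ntr (word_mx Ux (w ord0) *
          \prod_(k < n)
            (perm_mx (B d (j k)) * word_mx Ux (w (lift ord0 k))))%R])%E
    @[d --> \oo] --> 0%E.
Proof.
(* A common bound on the fixed points of all the [B_j] involved. *)
pose f d := (\sum_(k < n) fixed_points (B d (j k)))%N.
pose blocks d := [seq (B d (j k), word_of (w (lift ord0 k))) | k <- enum 'I_n].
pose s d := word_steps (word_of (w ord0)) (block_steps (blocks d)).
pose L := (size (word_of (w ord0)) +
           \sum_(k < n) size (word_of (w (lift ord0 k))))%N.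
have s_size d : size (s d).2 = L.
  by rewrite size_word_steps size_block_steps big_map big_enum.
have fix_le d k : (fixed_points (B d (j k)) <= f d)%N.
  by rewrite /f (bigD1 k) //= leq_addr.
have word_neq_nil (u : free_group I) : u <> 1%g -> word_of u != [::].
  by move=> u1; apply/eqP => u0; apply: u1; exact: val_inj.
have blocks_inner d : inner_nonempty (blocks d).
  rewrite /inner_nonempty sorted_map.
  apply: (@sub_sorted _ (fun k l : 'I_n => (k < l)%N)).
    move=> k l kl /=; apply/word_neq_nil/w_inner.
    by rewrite lift0 /= (leq_trans _ (ltn_ord l)).
  by have := iota_ltn_sorted 0 n; rewrite -val_enum_ord sorted_map.
have [s_sorted s_fix] : (forall d, sorted (rarely_retraces (f d)) (s d).2) /\
    (forall d, (s d).2 = [::] -> fixed_points (s d).1 <= f d)%N.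
  suff H d : sorted (rarely_retraces (f d)) (s d).2 /\
      ((s d).2 = [::] -> fixed_points (s d).1 <= f d)%N.
    by split=> d; have [] := H d.
  have blocks_ok : all (fun b => no_backtrack b.2 &&
                                 (fixed_points b.1 <= f d)%N) (blocks d).
    apply/allP => _ /mapP[k _ ->] /=; rewrite fix_le andbT.
    exact: word_of_reduced.
  have [b_sorted b_fix] := block_steps_sorted (blocks_inner d) blocks_ok.
  split; first by apply: word_steps_sorted => //; exact: word_of_reduced.
  (* Without letters, [w_0] is trivial, so that [n > 0], and the product is the
     first of the [B_j]. *)
  move/eqP; rewrite -size_eq0 size_word_steps addn_eq0 => /andP[/nilP w0 _].
  rewrite /s w0 /=; case E: (blocks d) (blocks_inner d) blocks_ok => [|b bw] b_in.
    have n0 : n = 0%N.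
      by have := congr1 size E; rewrite size_map size_enum_ord.
    by have := word_neq_nil _ (w_n0 n0); rewrite w0.
  by rewrite block_steps_head // => /andP[/andP[_ ->]].
have f_lim : (f d)%:R / d%:R @[d --> \oo] --> (0 : R).
  rewrite (_ : (fun d => _) = (fun d => \sum_(k < n) ntr (perm_mx (B d (j k))))).
    have zero : (0 : R) = \sum_(k < n) 0 by rewrite big1.
    rewrite [X in _ --> X]zero; apply: cvg_big => [|k _]; last exact: B_tr.
    by move=> x; apply: cvgD; [exact: cvg_fst|exact: cvg_snd].
  apply/funext => d; rewrite /f natr_sum mulr_suml.
  by apply: eq_bigr => k _; rewrite trace_perm_mx.
have prodE d x : word_mx (fun i => perm_mx (U d i x) : 'M[R]_d) (w ord0) *
    \prod_(k < n) (perm_mx (B d (j k)) *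
      word_mx (fun i => perm_mx (U d i x)) (w (lift ord0 k))) =
    perm_mx (steps_perm (fun i => U d i x) (s d)).
  rewrite steps_perm_word steps_perm_block perm_mxM word_mx_perm; congr (_ * _).
  rewrite big_map (_ : enum 'I_n = index_enum 'I_n) /=; last first.
    by rewrite enumT [index_enum _]unlock.
  elim/big_ind2: _ => [|A a A' a' -> ->|k _]; first by rewrite perm_mx1.
    by rewrite perm_mxM.
  by rewrite perm_mxM word_mx_perm.
have bound : ((L.+1 * (L.+1 + f d))%:R / (d - L)%:R)%:E @[d --> \oo] --> (0 : R)%:E.
  by apply: cvg_EFin; [exact: nearW|exact: cvg_steps_bound].
apply: (squeeze_cvge _ (cvg_cst 0%E) bound); near=> d.
have Ld : (L < d)%N by near: d; exact: nbhs_infty_gt.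
have [|r rE r_le] :=
  expectation_ntr_steps (U_indep d) (U_unif d) (s_sorted d) (s_fix d).
  by rewrite s_size.
under eq_fun do rewrite /= prodE.
by rewrite rE !lee_fin; rewrite s_size in r_le.
Unshelve. all: by end_near. Qed.
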